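(* There exists a bounded CAD cell in $\mathbb{R}^4$ whose closure (in the Euclidean topology) is not simply connected (and hence not contractible).
   Context: For $S\subseteq\mathbb{R}^n$, $\mathcal{S}^0(S)$ denotes the ring of continuous semi-algebraic functions $S\to\mathbb{R}$. For $f\in\mathcal{S}^0(S)$, the section with base $S$ and bound $f$ is the graph $S\odot\{f\}=\{(\mathbf{x},y)\in\mathbb{R}^{n+1} : \mathbf{x}\in S,\ y=f(\mathbf{x})\}$. For $l\in\mathcal{S}^0(S)\cup\{-\infty\}$ and $u\in\mathcal{S}^0(S)\cup\{+\infty\}$ with $l<u$ on $S$, the sector with base $S$ and bounds $l,u$ is $S\odot(l,u)=\{(\mathbf{x},y)\in\mathbb{R}^{n+1} : \mathbf{x}\in S,\ l(\mathbf{x})<y<u(\mathbf{x})\}$. CAD cells are defined inductively: a CAD cell of $\mathbb{R}$ is either a singleton $\{\xi\}$ with $\xi$ real algebraic, or a nonempty open interval whose endpoints are real algebraic numbers or $\pm\infty$; for $n>1$, a CAD cell of $\mathbb{R}^n$ is a section or a sector whose base is a CAD cell of $\mathbb{R}^{n-1}$. *)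

(* Defs.v *)
From HB Require Import structures.
From mathcomp Require Import all_boot all_order all_algebra.
From mathcomp Require Import all_classical all_reals all_analysis.
(* Not imported: its notations clash with those of mathcomp-analysis. *)
From mathcomp Require mpoly.

Set Implicit Arguments.
Unset Strict Implicit.
Unset Printing Implicit Defensive.

Import Order.TTheory GRing.Theory Num.Theory.
Import numFieldNormedType.Exports.

Local Open Scope classical_set_scope.
Local Open Scope ring_scope.

(* [R^n] is ['rV[R]_n]; its sup norm induces the Euclidean topology and the
   Euclidean bounded sets. *)

(* The Boolean algebra of sets generated by the sets [p > 0], [p] ranging over
   the real polynomials in [n] variables. *)
Inductive semialgebraic (R : realType) (n : nat) : set 'rV[R]_n -> Prop :=
| semialgebraic_pos (p : mpoly.mpoly n R) :
    semialgebraic [set x : 'rV[R]_n | 0 < mpoly.meval (x 0) p]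
| semialgebraicU (A B : set 'rV[R]_n) :
    semialgebraic A -> semialgebraic B -> semialgebraic (A `|` B)
| semialgebraicI (A B : set 'rV[R]_n) :
    semialgebraic A -> semialgebraic B -> semialgebraic (A `&` B)
| semialgebraicC (A : set 'rV[R]_n) :
    semialgebraic A -> semialgebraic (~` A).

(* A point of [R^(n + 1)] is [v = (x, y)] with [x = lsubmx v] and
   [y = rsubmx v 0 0]. *)
Definition section_over (R : realType) (n : nat) (S : set 'rV[R]_n)
    (f : 'rV[R]_n -> R) : set 'rV[R]_(n + 1) :=
  [set v | S (lsubmx v) /\ rsubmx v 0 0 = f (lsubmx v)].

Definition sector_over (R : realType) (n : nat) (S : set 'rV[R]_n)
    (l u : 'rV[R]_n -> \bar R) : set 'rV[R]_(n + 1) :=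
  [set v | S (lsubmx v) /\
           (l (lsubmx v) < (rsubmx v 0 0)%:E < u (lsubmx v))%E].

(* A function [S -> R] is represented by a total function, whose values outside
   [S] are irrelevant; [section_over S f] is its graph. *)
Definition cont_semialgebraic (R : realType) (n : nat) (S : set 'rV[R]_n)
    (f : 'rV[R]_n -> R) : Prop :=
  {within S, continuous f} /\ semialgebraic (section_over S f).

Definition real_algebraic (R : realType) (x : R) : Prop :=
  algebraicOver (ratr : rat -> R) x.

(* In the two sector-like cases, a bound is a function (or a number) with values
   in [\bar R] which is either infinite, of the appropriate sign, or finite. *)
Inductive cad_cell (R : realType) : forall n : nat, set 'rV[R]_n -> Prop :=
| cad_cell_point (xi : R) :
    real_algebraic xi ->
    cad_cell [set x : 'rV[R]_1 | x 0 0 = xi]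
| cad_cell_interval (a b : \bar R) :
    a = -oo%E \/ (exists2 r : R, real_algebraic r & a = r%:E) ->
    b = +oo%E \/ (exists2 r : R, real_algebraic r & b = r%:E) ->
    (a < b)%E ->
    cad_cell [set x : 'rV[R]_1 | (a < (x 0 0)%:E < b)%E]
| cad_cell_section (n : nat) (S : set 'rV[R]_n) (f : 'rV[R]_n -> R) :
    cad_cell S ->
    cont_semialgebraic S f ->
    cad_cell (section_over S f)
| cad_cell_sector (n : nat) (S : set 'rV[R]_n) (l u : 'rV[R]_n -> \bar R) :
    cad_cell S ->
    l = cst -oo%E \/
      (exists2 f : 'rV[R]_n -> R, cont_semialgebraic S f & l = EFin \o f) ->
    u = cst +oo%E \/
      (exists2 f : 'rV[R]_n -> R, cont_semialgebraic S f & u = EFin \o f) ->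
    (forall x, S x -> (l x < u x)%E) ->
    cad_cell (sector_over S l u).

(* Paths and homotopies are total functions, of which only the restriction to
   the unit interval, the unit square or a cylinder matters. *)
Definition path_in (R : realType) (T : topologicalType) (A : set T)
    (x y : T) (g : R -> T) : Prop :=
  [/\ {within `[0, 1], continuous g},
      forall s, s \in `[0, 1] -> A (g s),
      g 0 = x & g 1 = y].

(* Null-homotopic relative to the base point [x]. *)
Definition null_homotopic_loop (R : realType) (T : topologicalType) (A : set T)
    (x : T) (g : R -> T) : Prop :=
  exists H : R * R -> T,
    [/\ {within `[0, 1] `*` `[0, 1], continuous H},
        forall s t, s \in `[0, 1] -> t \in `[0, 1] -> A (H (s, t)),
        forall s, s \in `[0, 1] -> H (s, 0) = g s /\ H (s, 1) = x &
        forall t, t \in `[0, 1] -> H (0, t) = x /\ H (1, t) = x].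

Definition simply_connected (R : realType) (T : topologicalType) (A : set T)
    : Prop :=
  (forall x y, A x -> A y -> exists g : R -> T, path_in A x y g) /\
  (forall (x : T) (g : R -> T), path_in A x x g -> null_homotopic_loop A x g).

Definition contractible (R : realType) (T : topologicalType) (A : set T)
    : Prop :=
  exists (a : T) (H : T * R -> T),
    [/\ A a,
        {within A `*` `[0, 1], continuous H},
        forall x t, A x -> t \in `[0, 1] -> A (H (x, t)) &
        forall x, A x -> H (x, 0) = x /\ H (x, 1) = a].

(* Main.v *)
(** The cell is
    [{(x, y, z, w) : 0 < x < 1, -x < y < x, z = s^2 - 1, w = s z}] with
    [s = y / x]. Letting [x] tend to [0] at fixed slope [s], its closure contains
    the whole loop [(0, 0, s^2 - 1, s (s^2 - 1))], [-1 <= s <= 1], whereas the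
    projection to [(z, w)] maps the closure into the nodal cubic
    [w^2 = z^2 (z + 1)], on which this loop is essential. For the latter, cut the
    cubic into the arcs [z > -3/4], [z <= -3/4 /\ w >= 0] and
    [z <= -3/4 /\ w < 0]. On a fine grid in the unit square, a homotopy sends the
    corners of each small square into two of the arcs at most, so the parity of
    the number of edges joining the first two arcs is the same in all rows (as in
    Sperner's lemma); but it is odd for the loop and even for a constant map.
    Only the equality of the two vertical sides of the square is used, so free
    homotopies, hence contractions, are excluded as well. *)

Require Import Defs.
From HB Require Import structures.
From mathcomp Require Import all_boot all_order all_algebra.
From mathcomp Require Import all_classical all_reals all_analysis.
From mathcomp Require Import ring lra.
(* The notations of mpoly clash with those of mathcomp-analysis. *)
From mathcomp Require mpoly.
Import (canonicals) mpoly.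

Import Order.TTheory GRing.Theory Num.Theory.
Import numFieldNormedType.Exports.

Local Open Scope classical_set_scope.
Local Open Scope ring_scope.

(** * Parity of edge counts on a grid *)

(** Consecutive rows differ in parity by the sum of [v i j (+) v i.+1 j] over [i], which telescopes
    to [v 0 j (+) v n j] and vanishes since the vertical sides agree. *)
Lemma grid_parity (h v : nat -> nat -> bool) (n : nat) :
  (forall i j, (i < n)%N -> (j < n)%N ->
     h i j (+) h i j.+1 = v i j (+) v i.+1 j) ->
  (forall j, (j < n)%N -> v 0%N j = v n j) ->
  \big[addb/false]_(i < n) h i 0%N = \big[addb/false]_(i < n) h i n.
Proof.
move=> hv v0n.
suff rows j : (j <= n)%N ->
    \big[addb/false]_(i < n) h i 0%N = \big[addb/false]_(i < n) h i j.
  exact: rows.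
elim: j => // j IHj jn; rewrite IHj 1?ltnW//; apply/eqP.
rewrite -[_ == _]negbK negb_eqb -big_split/=.
rewrite (eq_bigr (fun i : 'I_n => v i j (+) v i.+1 j)) => [|i _]; last exact: hv.
suff -> k : \big[addb/false]_(i < k) (v i j (+) v i.+1 j) = v 0%N j (+) v k j.
  by rewrite -v0n// addbb.
elim: k => [|k IHk]; first by rewrite big_ord0 addbb.
by rewrite big_ord_recr/= IHk addbA addbK.
Qed.

Definition crosses {T : Type} (a b : pred T) (p q : T) : bool :=
  a p && b q || b p && a q.

(** The second hypothesis forbids that [a], [b] and neither of them all occur at the corners. So
    either [a] or [b] is absent and no edge counts, or every corner lies in [a] or [b] and the
    colour changes an even number of times around the square. *)
Lemma crosses_square (T : Type) (a b : pred T) (p q p' q' : T) :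
  (forall x, ~~ (a x && b x)) ->
  ~~ [&& [|| a p, a q, a p' | a q'], [|| b p, b q, b p' | b q'] &
      [|| ~~ (a p || b p), ~~ (a q || b q), ~~ (a p' || b p')
        | ~~ (a q' || b q')]] ->
  crosses a b p q (+) crosses a b p' q' =
  crosses a b p p' (+) crosses a b q q'.
Proof.
rewrite /crosses => ab.
move: (ab p) (ab q) (ab p') (ab q').
by case: (a p) (b p) (a q) (b q) (a p') (b p') (a q') (b q')
  => [] [] [] [] [] [] [] [].
Qed.

(** * Uniform continuity on the unit square *)

(** Compactness, in its near-covering form, turns local moduli of continuity into one mesh valid on
    the whole square. *)
Lemma within_square_unif_continuous (R : realType) (f : R * R -> R) (e : R) :
  0 < e -> {within `[0, 1] `*` `[0, 1], continuous f} ->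
  \forall n \near \oo, forall p q, (`[0, 1] `*` `[0, 1]) p ->
    (`[0, 1] `*` `[0, 1]) q ->
    `|p.1 - q.1| <= n.+1%:R^-1 -> `|p.2 - q.2| <= n.+1%:R^-1 ->
    `|f p - f q| < e.
Proof.
move=> e0 /subspace_continuousP fc.
pose P n (p : R * R) := forall q, (`[0, 1] `*` `[0, 1]) p ->
  (`[0, 1] `*` `[0, 1]) q -> `|p.1 - q.1| <= n.+1%:R^-1 ->
  `|p.2 - q.2| <= n.+1%:R^-1 -> `|f p - f q| < e.
have /compact_near_coveringP cov : compact (`[(0 : R), 1] `*` `[(0 : R), 1]).
  by apply: compact_setX; exact: segment_compact.
suff : \forall n \near \oo, `[0, 1] `*` `[0, 1] `<=` P n.
  by apply: filterS => n Pn p q Kp; exact: Pn.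
apply: cov => x Kx.
have /nbhs_ballP[d /= d0 xd] :
    \forall p \near x, (`[0, 1] `*` `[0, 1]) p -> `|f x - f p| < e / 2.
  have := fc x Kx; move/cvgrPdist_lt => /(_ (e / 2)).
  by rewrite divr_gt0// => /(_ isT).
have d20 : 0 < d / 2 by rewrite divr_gt0.
(* Half of [d] for [p] and half for the mesh keep [q] within [d] of [x], so that [f p] and [f q] are
   both compared with [f x]. *)
exists (ball x (d / 2), [set n | n.+1%:R^-1 < d / 2]) => /=.
  split; first exact: nbhsx_ballx.
  exact: (near_infty_natSinv_lt (PosNum d20)).
move=> [p n] /= [[xp1 xp2] nd] q Kp Kq pq1 pq2.
have xp : ball x d p.
  by split; apply: le_ball; [|exact: xp1| |exact: xp2]; lra.
have xq : ball x d q.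
  split; rewrite [d]splitr.
    exact: ball_triangle xp1 (le_lt_trans pq1 nd).
  exact: ball_triangle xp2 (le_lt_trans pq2 nd).
rewrite (splitr e) (le_lt_trans (ler_distD (f x) _ _))// ltrD//.
  by rewrite distrC xd.
exact: xd.
Qed.

(** * Arcs of the nodal cubic and the parity of the loop *)

(** In the parametrisation [z = s^2 - 1], [w = s (s^2 - 1)] of the cubic, [z = -3/4] at [s = 1/2]
    and [s = -1/2]. This arc is thus [|s| > 1/2] and contains the node; the upper arc below is
    [-1/2 <= s <= 0]. *)
Definition outer_arc {R : realType} (p : R * R) : bool := - (3 / 4) < p.1.

Definition upper_arc {R : realType} (p : R * R) : bool :=
  (p.1 <= - (3 / 4)) && (0 <= p.2).

(** Closeness to [p] puts [q.1] and [r.1] in [(-7/8, -3/4]], where the cubic has [|w| > 1/4]. As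
    [q.2] and [r.2] have opposite signs, they are more than 1/2 apart. *)
Lemma arcs_far_apart (R : realType) (p q r : R * R) :
  q.2 ^+ 2 = q.1 ^+ 2 * (q.1 + 1) -> r.2 ^+ 2 = r.1 ^+ 2 * (r.1 + 1) ->
  `|p.1 - q.1| < 8^-1 -> `|p.1 - r.1| < 8^-1 -> `|q.2 - r.2| < 8^-1 ->
  outer_arc p -> upper_arc q -> ~~ (outer_arc r || upper_arc r) -> False.
Proof.
case: p q r => [zp wp] [zq wq] [zr wr] /=.
rewrite /outer_arc /upper_arc /= negb_or negb_and -leNgt -!ltNge.
move=> Eq Er pq pr qr hp /andP[zq_le wq_ge] /andP[zr_le].
rewrite ltNge zr_le/= => wr_lt.
(* Here [z^2 >= 9/16] and [z + 1 > 1/8], while [9/128 > 1/16]. *)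
have far (z w : R) : w ^+ 2 = z ^+ 2 * (z + 1) -> - (7 / 8) < z -> z <= - (3 / 4) ->
    (4^-1) ^+ 2 < w ^+ 2.
  move=> -> z1 z2; nra.
have /(far _ _ Eq) := zq_le; have /(far _ _ Er) := zr_le.
move: pq pr qr; rewrite !ltr_norml => /andP[? ?] /andP[? ?] /andP[? ?] fr fq.
have {}fr : (4^-1) ^+ 2 < wr ^+ 2 by apply: fr; lra.
have {}fq : (4^-1) ^+ 2 < wq ^+ 2 by apply: fq; lra.
nra.
Qed.

(** At time [s] the loop has slope [2 * s - 1], so [z + 3/4] is a quadratic in [s] with roots 1/4
    and 3/4. *)
Lemma outer_arc_param (R : realType) (s : R) :
  (- (3 / 4) < (2 * s - 1) ^+ 2 - 1) = ~~ (4^-1 <= s <= 3 / 4).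
Proof.
have -> : (2 * s - 1) ^+ 2 - 1 = - (3 / 4) + 4 * ((s - 4^-1) * (s - 3 / 4)).
  by field.
rewrite ltrDl pmulr_rgt0 ?ltr0n// negb_and -!ltNge.
case: (ltP s 4^-1) => [?|?] /=; first by rewrite nmulr_rgt0; lra.
case: (ltP (3 / 4) s) => [?|?]; first by apply: mulr_gt0; lra.
by apply/negbTE; rewrite -leNgt mulr_ge0_le0//; lra.
Qed.

(** Between the times 1/4 and 3/4, [z] is negative, so [w >= 0] amounts to a slope of at most 0. *)
Lemma upper_arc_param (R : realType) (s : R) : 0 <= s <= 1 ->
  ((2 * s - 1) ^+ 2 - 1 <= - (3 / 4)) &&
    (0 <= (2 * s - 1) * ((2 * s - 1) ^+ 2 - 1)) = (4^-1 <= s <= 2^-1).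
Proof.
move=> /andP[s0 s1]; rewrite leNgt outer_arc_param negbK.
apply/idP/idP => [/andP[/andP[s4 s34] h]|/andP[s4 s2]].
  rewrite s4 /= leNgt; apply/negP => s2; move: h; apply/negP; rewrite -ltNge.
  by rewrite pmulr_rlt0; nra.
apply/andP; split; first by apply/andP; split; lra.
by apply: mulr_le0; nra.
Qed.

(* The partial parities record whether the branch [s < -1/2] has been left. *)
Lemma nodal_loop_crossings_odd (R : realType) (p : R -> R * R) (n : nat) :
  (forall t, t \in `[0, 1] ->
     p t = ((2 * t - 1) ^+ 2 - 1, (2 * t - 1) * ((2 * t - 1) ^+ 2 - 1))) ->
  (3 <= n)%N ->
  \big[addb/false]_(i < n.+1)
    crosses outer_arc upper_arc (p (i%:R / n.+1%:R)) (p (i.+1%:R / n.+1%:R)).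
Proof.
move=> pE n3.
pose t (i : nat) : R := i%:R / n.+1%:R.
have tS i : t i.+1 = t i + n.+1%:R^-1 by rewrite /t -natr1 mulrDl mul1r.
have d0 : 0 < n.+1%:R^-1 :> R by rewrite invr_gt0 ltr0n.
(* A step of at most 1/4 can jump neither over the times [[1/4, 1/2]] of the upper arc nor over the
   times [(1/2, 3/4]] of the lower one. The only edge counted is therefore the one reaching the
   upper arc at 1/4. *)
have d4 : n.+1%:R^-1 <= 4^-1 :> R by rewrite lef_pV2 ?posrE ?ltr0n// ler_nat.
have tn : t n.+1 = 1 by rewrite /t divff// pnatr_eq0.
have t01 i : (i <= n.+1)%N -> 0 <= t i <= 1.
  move=> i_le; rewrite /t divr_ge0//= ler_pdivrMr ?ltr0n// mul1r ler_nat//.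
suff parity k : (k <= n.+1)%N -> \big[addb/false]_(i < k)
    crosses outer_arc upper_arc (p (t i)) (p (t i.+1)) = (4^-1 <= t k).
  by rewrite parity// tn; lra.
elim: k => [|k IHk] kn.
  by rewrite big_ord0 /t mul0r; apply/esym/negbTE; rewrite -ltNge; lra.
rewrite big_ord_recr/= IHk 1?ltnW//.
have := t01 _ kn; have := t01 _ (ltnW kn).
move: (tS k); move: (t k) (t k.+1) => x y -> /andP[x0 x1] /andP[y0 y1].
rewrite !pE ?in_itv/= ?x0 ?y0//.
set d := n.+1%:R^-1 in d0 d4 y0 y1 *.
rewrite /crosses /outer_arc /upper_arc/=.
rewrite !outer_arc_param !upper_arc_param ?x0 ?y0//.
case: (leP 4^-1 x) => [x4|x4] /=.
- have -> : 4^-1 <= x + d by lra.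
  rewrite /=; case: (leP x (3 / 4)) => [x34|x34] /=; last first.
    have -> : (x + d <= 2^-1) = false by apply/negbTE; rewrite -ltNge; lra.
    by have -> : (x <= 2^-1) = false by apply/negbTE; rewrite -ltNge; lra.
  case: (leP (x + d) (3 / 4)) => [?|?] /=; first by rewrite !andbF.
  have -> : (x <= 2^-1) = false by apply/negbTE; rewrite -ltNge; lra.
  by [].
- case: (leP 4^-1 (x + d)) => //= ?.
  have -> : x + d <= 2^-1 by lra.
  by [].
Qed.

(** [Z] and [W] are the coordinates of a homotopy in the plane of the cubic. The grid argument
    carries the odd count of the bottom row to the top row, where the count is zero. *)
Lemma nodal_loop_essential (R : realType) (Z W : R * R -> R) :
  {within `[0, 1] `*` `[0, 1], continuous Z} ->
  {within `[0, 1] `*` `[0, 1], continuous W} ->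
  (forall s t, s \in `[0, 1] -> t \in `[0, 1] ->
     W (s, t) ^+ 2 = Z (s, t) ^+ 2 * (Z (s, t) + 1)) ->
  (forall s, s \in `[0, 1] ->
     Z (s, 0) = (2 * s - 1) ^+ 2 - 1 /\
     W (s, 0) = (2 * s - 1) * ((2 * s - 1) ^+ 2 - 1)) ->
  (forall t, t \in `[0, 1] ->
     Z (0, t) = Z (1, t) /\ W (0, t) = W (1, t)) ->
  (forall s, s \in `[0, 1] -> Z (s, 1) = Z (0, 1) /\ W (s, 1) = W (0, 1)) ->
  False.
Proof.
move=> Zc Wc nodal bot sides top.
have e0 : 0 < 8^-1 :> R by rewrite invr_gt0.
(* The mesh serves both coordinates with the tolerance 1/8 of [arcs_far_apart], and is fine enough
   for the count on the bottom row. *)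
have [n [n3 Zn Wn]] : exists n, [/\ (3 <= n)%N,
    forall p q : R * R, (`[0, 1] `*` `[0, 1]) p ->
      (`[0, 1] `*` `[0, 1]) q ->
      `|p.1 - q.1| <= n.+1%:R^-1 -> `|p.2 - q.2| <= n.+1%:R^-1 ->
      `|Z p - Z q| < 8^-1 &
    forall p q : R * R, (`[0, 1] `*` `[0, 1]) p ->
      (`[0, 1] `*` `[0, 1]) q ->
      `|p.1 - q.1| <= n.+1%:R^-1 -> `|p.2 - q.2| <= n.+1%:R^-1 ->
      `|W p - W q| < 8^-1].
  have [n [[]]] := filter_ex (filterI
    (filterI (within_square_unif_continuous _ _ _ e0 Zc)
             (within_square_unif_continuous _ _ _ e0 Wc)) (nbhs_infty_ge 3)).
  by exists n.
pose t (i : nat) : R := i%:R / n.+1%:R.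
pose F i j := (Z (t i, t j), W (t i, t j)).
have t01 i : (i <= n.+1)%N -> t i \in `[0, 1].
  move=> i_le; rewrite in_itv/= /t divr_ge0//= ler_pdivrMr ?ltr0n// mul1r.
  by rewrite ler_nat.
have t0 : t 0%N = 0 by rewrite /t mul0r.
have tn : t n.+1 = 1 by rewrite /t divff// pnatr_eq0.
have tclose i j : (i <= j.+1)%N -> (j <= i.+1)%N -> `|t i - t j| <= n.+1%:R^-1.
  move=> ij ji; rewrite /t -mulrBl normrM [X in _ * X]ger0_norm ?invr_ge0//.
  rewrite -[leRHS]mul1r ler_wpM2r ?invr_ge0// ler_norml.
  move: ij ji; rewrite -(ler_nat R) -(ler_nat R j) -!natr1 => ? ?.
  by apply/andP; split; lra.
pose near_corner k i := ((k == i) || (k == i.+1)).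
(* Any two corners of one small square, diagonal ones included, have images within 1/8 in both
   coordinates. *)
have corner i j x x' y y' : (i < n.+1)%N -> (j < n.+1)%N ->
    near_corner x i -> near_corner x' i -> near_corner y j -> near_corner y' j ->
    `|(F x y).1 - (F x' y').1| < 8^-1 /\ `|(F x y).2 - (F x' y').2| < 8^-1.
  move=> i_lt j_lt /orP xi /orP xi' /orP yj /orP yj'.
  have bound k m : (m < n.+1)%N -> k == m \/ k == m.+1 -> (k <= n.+1)%N.
    by move=> mn [] /eqP->//; exact: ltnW.
  have near k k' m : k == m \/ k == m.+1 -> k' == m \/ k' == m.+1 ->
      `|t k - t k'| <= n.+1%:R^-1.
    by move=> [] /eqP-> [] /eqP->; apply: tclose => //; exact: leqW.
  split; [apply: Zn|apply: Wn]; do ?split; rewrite /=;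
    by [apply: t01; eauto|eauto].
have arcs p : ~~ (outer_arc p && upper_arc p) :> bool.
  by rewrite /outer_arc /upper_arc; case: (ltP (- (3 / 4)) p.1).
have FE i j : (i <= n.+1)%N -> (j <= n.+1)%N ->
    (F i j).2 ^+ 2 = (F i j).1 ^+ 2 * ((F i j).1 + 1).
  by move=> ? ?; apply: nodal; exact: t01.
have parity := @grid_parity
  (fun i j => crosses outer_arc upper_arc (F i j) (F i.+1 j))
  (fun i j => crosses outer_arc upper_arc (F i j) (F i j.+1)) n.+1.
have odd_bot := nodal_loop_crossings_odd R (fun s => (Z (s, 0), W (s, 0))) n.
rewrite /= in parity odd_bot.
have : \big[addb/false]_(i < n.+1) crosses outer_arc upper_arc (F i 0%N) (F i.+1 0%N).
  rewrite /F t0; apply: odd_bot => // s s01.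
  by have [-> ->] := bot s s01.
rewrite parity.
(* On the top row both ends of an edge have the same image, which cannot lie in two disjoint
   arcs. *)
- rewrite big1// => i _; rewrite /F tn.
  have [-> ->] := top (t i) (t01 _ (ltnW (ltn_ord i))).
  have [-> ->] := top (t i.+1) (t01 _ (ltn_ord i)).
  by rewrite /crosses [X in _ || X]andbC orbb; exact/negbTE/arcs.
- move=> i j i_lt j_lt; apply: crosses_square => //.
  (* If all three arcs occurred, a corner chosen in each would contradict [arcs_far_apart]. *)
  apply/negP => /and3P[A B C].
  have pick (P : pred (R * R)) : [|| P (F i j), P (F i.+1 j), P (F i j.+1)
      | P (F i.+1 j.+1)] -> exists x y, [/\ near_corner x i, near_corner y j
      & P (F x y)].
    by move=> /or4P[] ?; [exists i, j|exists i.+1, j|exists i, j.+1|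
      exists i.+1, j.+1]; rewrite /near_corner !eqxx ?orbT.
  have [x1 [y1 [xi1 yj1 ap]]] := pick outer_arc A.
  have [x2 [y2 [xi2 yj2 bq]]] := pick upper_arc B.
  have [x3 [y3 [xi3 yj3 cr]]] := pick (fun p => ~~ (outer_arc p || upper_arc p)) C.
  have bound k m : (m < n.+1)%N -> near_corner k m -> (k <= n.+1)%N.
    by move=> mn /orP[] /eqP->//; exact: ltnW.
  have c12 := corner i j x1 x2 y1 y2 i_lt j_lt xi1 xi2 yj1 yj2.
  have c13 := corner i j x1 x3 y1 y3 i_lt j_lt xi1 xi3 yj1 yj3.
  have c23 := corner i j x2 x3 y2 y3 i_lt j_lt xi2 xi3 yj2 yj3.
  apply: (arcs_far_apart R (F x1 y1) (F x2 y2) (F x3 y3)) => //.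
  + by apply: FE; eauto.
  + by apply: FE; eauto.
  + by case: c12.
  + by case: c13.
  + by case: c23.
- move=> j j_lt; rewrite /F t0 tn.
  have [-> ->] := sides (t j) (t01 _ (ltnW j_lt)).
  by have [-> ->] := sides (t j.+1) (t01 _ j_lt).
Qed.

(** * Coordinatewise convergence *)

Lemma cvg_rV (R : realType) (T : Type) (F : set_system T) (n : nat)
    {FF : Filter F} (f : T -> 'rV[R]_n) (l : 'rV[R]_n) :
  (forall j, f t 0 j @[t --> F] --> l 0 j) -> f @ F --> l.
Proof.
move=> fl; apply/cvg_ballP => e e0.
have : \forall t \near F, forall j, ball (l 0 j) e (f t 0 j).
  by apply: filter_forall => j; exact: (cvg_ball (fl j)).
by apply: filterS => t lft; split=> // i j; rewrite ord1.
Qed.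

(** * Polynomial functions and semi-algebraic sections *)

(** Hiding the polynomial behind an existential lets semi-algebraicity be read off from expressions
    in the coordinates. *)
Definition polynomial_fun {R : realType} {n : nat} (q : 'rV[R]_n -> R) : Prop :=
  exists p : mpoly.mpoly n R, forall x, q x = mpoly.meval (x 0) p.

Section polynomial_fun.
Context {R : realType} {n : nat}.
Implicit Types q r : 'rV[R]_n -> R.

Lemma polynomial_fun_cst (c : R) : polynomial_fun (fun _ : 'rV[R]_n => c).
Proof. by exists (mpoly.mpolyC n c) => x; rewrite mpoly.mevalC. Qed.

Lemma polynomial_fun_coord (i : 'I_n) : polynomial_fun (fun x : 'rV[R]_n => x 0 i).
Proof. by exists (mpoly.mpolyX R (mpoly.mnm1 i)) => x; rewrite mpoly.mevalXU. Qed.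

Lemma polynomial_funN q : polynomial_fun q -> polynomial_fun (fun x => - q x).
Proof. by move=> [p qp]; exists (- p) => x; rewrite qp mpoly.mevalN. Qed.

Lemma polynomial_funB q r : polynomial_fun q -> polynomial_fun r ->
  polynomial_fun (fun x => q x - r x).
Proof.
move=> [p qp] [p' rp]; exists (p - p') => x.
by rewrite qp rp mpoly.mevalB.
Qed.

Lemma polynomial_funM q r : polynomial_fun q -> polynomial_fun r ->
  polynomial_fun (fun x => q x * r x).
Proof.
move=> [p qp] [p' rp]; exists (p * p') => x.
by rewrite qp rp mpoly.mevalM.
Qed.

Lemma polynomial_fun_lsubmx q : polynomial_fun q ->
  polynomial_fun (fun v : 'rV[R]_(n + 1) => q (lsubmx v)).
Proof.
move=> [p qp].
exists (mpoly.comp_mpoly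
  [tuple mpoly.mpolyX R (mpoly.mnm1 (lshift 1 i)) | i < n] p) => v.
rewrite qp mpoly.comp_mpoly_meval; apply: mpoly.meval_eq => i.
by rewrite tnth_mktuple mpoly.mevalXU mxE.
Qed.

Lemma semialgebraic_lt q r : polynomial_fun q -> polynomial_fun r ->
  semialgebraic [set x | q x < r x].
Proof.
move=> qP rP; have [p qp] := polynomial_funB _ _ rP qP.
have -> : [set x | q x < r x] = [set x | 0 < mpoly.meval (x 0) p].
  by apply/seteqP; split => x /=; rewrite -qp subr_gt0.
exact: semialgebraic_pos.
Qed.

Lemma semialgebraic_eq q r : polynomial_fun q -> polynomial_fun r ->
  semialgebraic [set x | q x = r x].
Proof.
move=> qP rP.
have -> : [set x | q x = r x] = ~` ([set x | q x < r x] `|` [set x | r x < q x]).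
  apply/seteqP; split => x /=.
    by move=> ->; rewrite ltxx => -[].
  by move=> /not_orP[/negP + /negP]; case: ltgtP.
by apply: semialgebraicC; apply: semialgebraicU; exact: semialgebraic_lt.
Qed.

End polynomial_fun.

Lemma polynomial_fun_last (R : realType) (n : nat) :
  polynomial_fun (fun v : 'rV[R]_(n + 1) => rsubmx v 0 0).
Proof.
have [p pE] := @polynomial_fun_coord R (n + 1) (rshift n 0).
by exists p => v; rewrite mxE pE.
Qed.

(** Cylinders commute with the Boolean operations, so only the generators matter; for these, the
    polynomial is reread in one more variable. *)
Lemma semialgebraic_cylinder (R : realType) (n : nat) (S : set 'rV[R]_n) :
  semialgebraic S -> semialgebraic [set v : 'rV[R]_(n + 1) | S (lsubmx v)].
Proof.
elim=> {S} [p|A B _ SA _ SB|A B _ SA _ SB|A _ SA].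
- apply: semialgebraic_lt; first exact: polynomial_fun_cst.
  by apply: (@polynomial_fun_lsubmx _ _ (fun x => mpoly.meval (x 0) p)); exists p.
- exact: semialgebraicU.
- exact: semialgebraicI.
- exact: semialgebraicC.
Qed.

(** The equation [q = r] need describe the graph only over [S], which allows denominators that do
    not vanish on [S] to be cleared. *)
Lemma semialgebraic_section (R : realType) (n : nat) (S : set 'rV[R]_n)
    (f : 'rV[R]_n -> R) (q r : 'rV[R]_(n + 1) -> R) :
  semialgebraic S -> polynomial_fun q -> polynomial_fun r ->
  (forall v, S (lsubmx v) -> rsubmx v 0 0 = f (lsubmx v) <-> q v = r v) ->
  semialgebraic (section_over S f).
Proof.
move=> SS qP rP fqr.
have -> : section_over S f = [set v | S (lsubmx v)] `&` [set v | q v = r v].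
  by apply/seteqP; split=> v [Sv] /(fqr _ Sv).
by apply: semialgebraicI;
  [exact: semialgebraic_cylinder|exact: semialgebraic_eq].
Qed.

(** * Limits and continuity for block row vectors *)

Lemma cvg_row_mx (R : realType) (T : Type) (F : set_system T)
    {FF : Filter F} (m n : nat)
    (f : T -> 'rV[R]_m) (g : T -> 'rV[R]_n) (a : 'rV[R]_m) (b : 'rV[R]_n) :
  f @ F --> a -> g @ F --> b ->
  row_mx (f t) (g t) @[t --> F] --> row_mx a b.
Proof.
move=> fa gb; apply: cvg_rV => j; case: (split_ordP j) => i ->.
- rewrite row_mxEl; under eq_cvg do rewrite row_mxEl.
  exact: (cvg_comp _ _ fa (@coord_continuous _ _ _ 0 i a)).
- rewrite row_mxEr; under eq_cvg do rewrite row_mxEr.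
  exact: (cvg_comp _ _ gb (@coord_continuous _ _ _ 0 i b)).
Qed.

Lemma cvg_scalar_rV1 (R : realType) (T : Type) (F : set_system T)
    {FF : Filter F} (f : T -> R) (a : R) :
  f @ F --> a -> ((f t)%:M : 'rV[R]_1) @[t --> F] --> (a%:M : 'rV_1).
Proof.
move=> fa; apply: cvg_rV => j; rewrite ord1 mxE eqxx.
by under eq_cvg do rewrite mxE eqxx.
Qed.

Lemma lsubmx_coord_continuous (R : realType) (m n : nat) (i : 'I_m) :
  continuous (fun v : 'rV[R]_(m + n) => lsubmx v 0 i).
Proof.
rewrite (_ : (fun v => _) = fun v : 'rV[R]_(m + n) => v 0 (lshift n i)).
  exact: coord_continuous.
by apply/funext => v; rewrite mxE.
Qed.

Lemma rsubmx_coord_continuous (R : realType) (m n : nat) (i : 'I_n) :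
  continuous (fun v : 'rV[R]_(m + n) => rsubmx v 0 i).
Proof.
rewrite (_ : (fun v => _) = fun v : 'rV[R]_(m + n) => v 0 (rshift m i)).
  exact: coord_continuous.
by apply/funext => v; rewrite mxE.
Qed.

Lemma lsubmx_continuous (R : realType) (m n : nat) :
  continuous (fun v : 'rV[R]_(m + n) => lsubmx v).
Proof.
move=> v; apply: (@cvg_rV R _ (nbhs v) m (nbhs_filter v)) => j.
exact: lsubmx_coord_continuous.
Qed.

Lemma closed_nodal_cubic (R : realType) (T : topologicalType) (z w : T -> R) :
  continuous z -> continuous w ->
  closed [set v | w v ^+ 2 = z v ^+ 2 * (z v + 1)].
Proof.
move=> zc wc; pose q v := w v ^+ 2 - z v ^+ 2 * (z v + 1).
have qc : continuous q.
  move=> v; apply: cvgB; first by apply: cvgM; exact: wc.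
  apply: cvgM; first by apply: cvgM; exact: zc.
  by apply: cvgD; [exact: zc|exact: cvg_cst].
rewrite (_ : [set v | _] = q @^-1` [set 0]).
  by apply: preimage_closed => [v _|]; [exact: qc|exact: closed_eq].
by apply/seteqP; split=> v /=; rewrite /q; [move=> ->; rewrite subrr|
  move=> /eqP; rewrite subr_eq0 => /eqP].
Qed.

(** * The cell: construction, semi-algebraicity and boundedness *)

Section nodal_cell.
Context {R : realType}.

(** The nesting follows the tower of bases of the cell: each [lsubmx] removes the last
    coordinate. *)
Definition point4 (x y z w : R) : 'rV[R]_(1 + 1 + 1 + 1) :=
  row_mx (row_mx (row_mx (x%:M : 'rV_1) (y%:M : 'rV_1)) (z%:M : 'rV_1))
    (w%:M : 'rV_1).

Lemma cvg_point4 (T : Type) (F : set_system T) {FF : Filter F}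
    (x y z w : T -> R) (a b c d : R) :
  x @ F --> a -> y @ F --> b -> z @ F --> c -> w @ F --> d ->
  point4 (x t) (y t) (z t) (w t) @[t --> F] --> point4 a b c d.
Proof.
by move=> xa yb zc wd; do 3?[apply: cvg_row_mx]; exact: cvg_scalar_rV1.
Qed.

Definition unit_interval : set 'rV[R]_1 :=
  [set x : 'rV[R]_1 | (0%:E < (x 0 0)%:E < 1%:E)%E].

Definition wedge : set 'rV[R]_(1 + 1) :=
  sector_over unit_interval (EFin \o (fun x => - x 0 0)) (EFin \o (fun x => x 0 0)).

(** Continuous on the wedge, where [x > 0], but without a limit at the vertex: there every value in
    [[-1, 1]] is a limit along some ray or sequence in the wedge. *)
Definition slope (v : 'rV[R]_(1 + 1)) : R := rsubmx v 0 0 / lsubmx v 0 0.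

Definition nodal_z (v : 'rV[R]_(1 + 1)) : R := slope v ^+ 2 - 1.

Definition nodal_surface : set 'rV[R]_(1 + 1 + 1) := section_over wedge nodal_z.

Definition nodal_w (v : 'rV[R]_(1 + 1 + 1)) : R :=
  slope (lsubmx v) * rsubmx v 0 0.

Definition nodal_cell : set 'rV[R]_(1 + 1 + 1 + 1) :=
  section_over nodal_surface nodal_w.

Lemma wedgeP v : wedge v <->
  0 < lsubmx v 0 0 < 1 /\ - lsubmx v 0 0 < rsubmx v 0 0 < lsubmx v 0 0.
Proof. by rewrite /wedge /sector_over /unit_interval /= !lte_fin. Qed.

Lemma slope_continuous v : wedge v -> {for v, continuous slope}.
Proof.
move=> /wedgeP[/andP[x0 _] _]; apply: continuousM; first exact: rsubmx_coord_continuous.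
by apply: continuousV; [rewrite gt_eqF|exact: lsubmx_coord_continuous].
Qed.

Lemma semialgebraic_unit_interval : semialgebraic unit_interval.
Proof.
rewrite (_ : unit_interval =
  [set x : 'rV[R]_1 | 0 < x 0 0] `&` [set x : 'rV[R]_1 | x 0 0 < 1]).
  apply: semialgebraicI; apply: semialgebraic_lt;
    by [exact: polynomial_fun_cst|exact: polynomial_fun_coord].
by apply/seteqP; split=> x; rewrite /unit_interval /= !lte_fin => /andP.
Qed.

Lemma semialgebraic_wedge : semialgebraic wedge.
Proof.
have xP := @polynomial_fun_lsubmx R 1 _ (polynomial_fun_coord 0).
have yP := polynomial_fun_last R 1.
rewrite (_ : wedge = [set v | unit_interval (lsubmx v)] `&`
  ([set v : 'rV[R]_(1 + 1) | - lsubmx v 0 0 < rsubmx v 0 0] `&`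
   [set v : 'rV[R]_(1 + 1) | rsubmx v 0 0 < lsubmx v 0 0])).
  apply: semialgebraicI.
    exact: semialgebraic_cylinder semialgebraic_unit_interval.
  apply: semialgebraicI; apply: semialgebraic_lt => //.
  exact: polynomial_funN.
apply/seteqP; split=> v; rewrite /wedge /sector_over /= !lte_fin.
  by move=> [? /andP].
by move=> [? [-> ->]].
Qed.

Lemma cont_semialgebraic_nodal_z : cont_semialgebraic wedge nodal_z.
Proof.
split.
  apply: continuous_in_subspaceT => v; rewrite inE => wv.
  apply: (@continuous_comp _ _ _ slope (fun s : R => s ^+ 2 - 1)).
    exact: slope_continuous.
  by apply: cvgB; [apply: cvgM; exact: cvg_id|exact: cvg_cst].
have lP q := @polynomial_fun_lsubmx R (1 + 1) q.
have xP := lP _ (@polynomial_fun_lsubmx R 1 _ (polynomial_fun_coord 0)).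
have yP := lP _ (polynomial_fun_last R 1).
have zP := polynomial_fun_last R (1 + 1).
(* Cleared of denominators, the equation of the graph is [z x^2 = y^2 - x^2]. *)
apply: (semialgebraic_section _ _ _ _ _ _ semialgebraic_wedge
  (polynomial_funM _ _ zP (polynomial_funM _ _ xP xP))
  (polynomial_funB _ _ (polynomial_funM _ _ yP yP) (polynomial_funM _ _ xP xP))).
move=> v /wedgeP[/andP[x0 _] _]; rewrite /nodal_z /slope /=.
move: x0; set x := lsubmx _ 0 0; set y := rsubmx (lsubmx v) 0 0 => x0.
have xn : x != 0 by rewrite gt_eqF.
split=> [->|E]; first by field.
by apply: (mulIf (mulf_neq0 xn xn)); rewrite E; field.
Qed.

Lemma cont_semialgebraic_nodal_w : cont_semialgebraic nodal_surface nodal_w.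
Proof.
split.
  apply: continuous_in_subspaceT => v; rewrite inE => -[wv _].
  have sc : {for v, continuous (slope \o lsubmx)}.
    apply: continuous_comp; first exact: lsubmx_continuous.
    exact: slope_continuous.
  exact: (continuousM sc (@rsubmx_coord_continuous R (1 + 1) 1 0 v)).
have l3 q := @polynomial_fun_lsubmx R (1 + 1 + 1) q.
have l2 q := @polynomial_fun_lsubmx R (1 + 1) q.
have xP := l3 _ (l2 _ (@polynomial_fun_lsubmx R 1 _ (polynomial_fun_coord 0))).
have yP := l3 _ (l2 _ (polynomial_fun_last R 1)).
have zP := l3 _ (polynomial_fun_last R (1 + 1)).
have wP := polynomial_fun_last R (1 + 1 + 1).
(* Since [s = y / x], the equation [w = s z] becomes [w x = y z]. *)
apply: (semialgebraic_section _ _ _ _ _ _ (proj2 cont_semialgebraic_nodal_z)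
  (polynomial_funM _ _ wP xP) (polynomial_funM _ _ yP zP)).
move=> v [/wedgeP[/andP[x0 _] _] _]; rewrite /nodal_w /slope /=.
move: x0; set x := lsubmx _ 0 0 => x0.
have xn : x != 0 by rewrite gt_eqF.
split=> [->|E]; first by field.
by apply: (mulIf xn); rewrite E; field.
Qed.

Lemma cad_cell_nodal_cell : cad_cell nodal_cell.
Proof.
apply: cad_cell_section; last exact: cont_semialgebraic_nodal_w.
apply: cad_cell_section; last exact: cont_semialgebraic_nodal_z.
have xP := @polynomial_fun_lsubmx R 1 _ (polynomial_fun_coord 0).
have yP := polynomial_fun_last R 1.
have xc : continuous (fun x : 'rV[R]_1 => x 0 0) by exact: coord_continuous.
apply: cad_cell_sector.
- apply: cad_cell_interval; last by rewrite lte_fin.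
  + by right; exists 0 => //; exists 'X; rewrite ?polyX_eq0 ?map_polyX ?rootX.
  + right; exists 1 => //; exists ('X - 1%:P); first by rewrite polyXsubC_eq0.
    by rewrite rmorphB/= map_polyX map_polyC/= rmorph1 root_XsubC.
- right; eexists; last reflexivity; split.
    by apply: continuous_subspaceT => x; apply: continuousN; exact: xc.
  exact: (semialgebraic_section _ _ _ _ _ _ semialgebraic_unit_interval yP
    (polynomial_funN _ xP)).
- right; eexists; last reflexivity; split.
    exact: continuous_subspaceT.
  exact: (semialgebraic_section _ _ _ _ _ _ semialgebraic_unit_interval yP xP).
- by move=> x /andP[]; rewrite /= !lte_fin => x0 _; lra.
Qed.

(** From [|y| < x] follows [|s| <= 1], whence [z = s^2 - 1] and [w = s z] are bounded by 1 as
    well. *)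
Lemma nodal_cell_bounds v : nodal_cell v -> forall i, `|v 0 i| <= 1.
Proof.
rewrite /nodal_cell /nodal_surface /section_over /= => -[[wv zv] wE].
have sv : `|slope (lsubmx (lsubmx v))| <= 1.
  move/wedgeP: wv => [/andP[x0 x1] /andP[y1 y2]].
  rewrite /slope normf_div ler_pdivrMr ?normr_gt0 ?gt_eqF// mul1r.
  by rewrite [leRHS]gtr0_norm// ler_norml; apply/andP; split; exact: ltW.
have zv1 : `|rsubmx (lsubmx v) 0 0| <= 1.
  rewrite zv /nodal_z; move: sv; rewrite !ler_norml => /andP[? ?].
  by apply/andP; split; nra.
move/wedgeP: wv => [/andP[x0 x1] /andP[y1 y2]] i.
case: (split_ordP i) => {}i ->; last first.
  by move: wE; rewrite mxE ord1 => ->; rewrite normrM mulr_ile1.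
case: (split_ordP i) => {}i ->; last by move: zv1; rewrite !mxE ord1.
move: x0 x1 y1 y2; rewrite !mxE.
by case: (split_ordP i) => {}i ->; rewrite !ord1 ler_norml => *;
  apply/andP; split; lra.
Qed.

Lemma bounded_nodal_cell : bounded_set nodal_cell.
Proof.
exists 1; split=> // M M1 v /nodal_cell_bounds v1.
suff vM : `|v| <= 1 by exact: le_trans vM (ltW M1).
rewrite [leLHS]/Num.norm /= mx_normrE; apply/bigmax_leP; split => //.
by move=> [i j] _ /=; rewrite ord1; exact: v1.
Qed.

Lemma third_coord_continuous :
  continuous (fun v : 'rV[R]_(1 + 1 + 1 + 1) => rsubmx (lsubmx v) 0 0).
Proof.
move=> v; apply: (@continuous_comp _ _ _ (@lsubmx R 1 (1 + 1 + 1) 1)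
  (fun u => rsubmx u 0 0)); first exact: lsubmx_continuous.
exact: rsubmx_coord_continuous.
Qed.

(** On the cell, [w = s z] and [z + 1 = s^2] give the equation of the cubic, and this equation
    defines a closed set. *)
Lemma closure_nodal_cell v : closure nodal_cell v ->
  (rsubmx v 0 0) ^+ 2 =
    (rsubmx (lsubmx v) 0 0) ^+ 2 * (rsubmx (lsubmx v) 0 0 + 1).
Proof.
pose z (v : 'rV[R]_(1 + 1 + 1 + 1)) := rsubmx (lsubmx v) 0 0.
pose w (v : 'rV[R]_(1 + 1 + 1 + 1)) := rsubmx v 0 0.
have wc : continuous w by exact: rsubmx_coord_continuous.
have zc : continuous z by exact: third_coord_continuous.
have sub : nodal_cell `<=` [set v | w v ^+ 2 = z v ^+ 2 * (z v + 1)].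
  move=> u [[_ zE] wE]; rewrite /w /z /= wE /nodal_w zE /nodal_z; ring.
move=> /(closure_subset sub); rewrite -(closure_id _).1//.
exact: closed_nodal_cubic.
Qed.

(** * The loop in the closure *)

(** The slope [2 * t - 1] runs from -1 to 1; at both ends [z] and [w] vanish, so the loop is based
    at the origin, over the node. *)
Definition nodal_loop (t : R) : 'rV[R]_(1 + 1 + 1 + 1) :=
  point4 0 0 ((2 * t - 1) ^+ 2 - 1) ((2 * t - 1) * ((2 * t - 1) ^+ 2 - 1)).

Lemma nodal_loop_continuous : continuous nodal_loop.
Proof.
move=> t.
have sc : 2 * u - 1 @[u --> t] --> 2 * t - 1.
  by apply: cvgB; [apply: cvgM; [exact: cvg_cst|exact: cvg_id]|exact: cvg_cst].
have zc : (2 * u - 1) ^+ 2 - 1 @[u --> t] --> (2 * t - 1) ^+ 2 - 1.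
  by apply: cvgB; [exact: cvgM|exact: cvg_cst].
by apply: cvg_point4; [exact: cvg_cst|exact: cvg_cst|exact: zc|exact: cvgM].
Qed.

Lemma nodal_loop_ends : nodal_loop 0 = nodal_loop 1.
Proof.
by rewrite /nodal_loop; congr point4; ring.
Qed.

Lemma nodal_cell_point4 x s : 0 < x < 1 -> -1 < s < 1 ->
  nodal_cell (point4 x (x * s) (s ^+ 2 - 1) (s * (s ^+ 2 - 1))).
Proof.
move=> /andP[x0 x1] /andP[s0 s1].
have xn : x != 0 by rewrite gt_eqF.
rewrite /nodal_cell /nodal_surface /section_over /= /nodal_w /nodal_z /slope.
rewrite /point4 !(row_mxKl, row_mxKr).
split; last by rewrite !mxE /=; field.
split; last by rewrite !mxE /=; field.
apply/wedgeP; rewrite !(row_mxKl, row_mxKr) !mxE /= !mulr1n x0 x1.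
by split=> //; apply/andP; split; nra.
Qed.

(* [nodal_loop t] is the limit as [e] tends to [0+] of the point of the cell
   with abscissa [e] and slope [(1 - e) (2 t - 1)]. *)
Lemma nodal_loop_closure (t : R) : t \in `[0, 1] -> closure nodal_cell (nodal_loop t).
Proof.
rewrite in_itv/= => /andP[t0 t1].
(* The factor [1 - e] keeps the slope strictly between -1 and 1 even at the ends of the loop. *)
pose s (e : R) := (1 - e) * (2 * t - 1).
have ec : e @[e --> 0^'+] --> (0 : R).
  exact: cvg_within.
have sc : s e @[e --> 0^'+] --> 2 * t - 1.
  rewrite (_ : 2 * t - 1 = (1 - 0) * (2 * t - 1)); last by rewrite subr0 mul1r.
  by apply: cvgM; [apply: cvgB; [exact: cvg_cst|]|exact: cvg_cst].
apply: (closed_cvg (u_ := fun e => point4 e (e * s e) (s e ^+ 2 - 1)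
    (s e * (s e ^+ 2 - 1))) (F := 0^'+) (closure nodal_cell)).
- exact: closed_closure.
- near=> e; apply: subset_closure; apply: nodal_cell_point4.
    by apply/andP; split; near: e; [exact: nbhs_right_gt|exact: nbhs_right_lt].
  have e0 : 0 < e by near: e; exact: nbhs_right_gt.
  have e1 : e < 1 by near: e; exact: nbhs_right_lt.
  by rewrite /s; apply/andP; split; nra.
- have zc : s e ^+ 2 - 1 @[e --> 0^'+] --> (2 * t - 1) ^+ 2 - 1.
    by apply: cvgB; [exact: cvgM|exact: cvg_cst].
  apply: cvg_point4; [exact: ec| |exact: zc|exact: (cvgM sc zc)].
  have yc := cvgM ec sc; rewrite mul0r in yc. exact: yc.
Unshelve. all: by end_near.
Qed.

(** * Excluding null-homotopies and contractions *)

(** The projection to [(z, w)] carries such a homotopy into the nodal cubic, where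
    [nodal_loop_essential] applies. The base point may move, so that contractions are covered
    too. *)
Lemma nodal_loop_no_homotopy (H : R * R -> 'rV[R]_(1 + 1 + 1 + 1)) :
  {within `[0, 1] `*` `[0, 1], continuous H} ->
  (forall s t, s \in `[0, 1] -> t \in `[0, 1] -> closure nodal_cell (H (s, t))) ->
  (forall s, s \in `[0, 1] -> H (s, 0) = nodal_loop s /\ H (s, 1) = H (0, 1)) ->
  (forall t, t \in `[0, 1] -> H (0, t) = H (1, t)) -> False.
Proof.
move=> Hc Hcl Hs Ht.
apply: (@nodal_loop_essential R (fun p => rsubmx (lsubmx (H p)) 0 0)
  (fun p => rsubmx (H p) 0 0)).
- move=> p; exact: (continuous_comp (Hc p) (third_coord_continuous (H p))).
- move=> p.
  exact: (continuous_comp (Hc p) (@rsubmx_coord_continuous R _ _ 0 (H p))).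
- by move=> s t s01 t01; exact/closure_nodal_cell/Hcl.
- move=> s s01; have [-> _] := Hs s s01; rewrite /nodal_loop /point4.
  by rewrite row_mxKl !row_mxKr !mxE /=.
- by move=> t t01; rewrite Ht.
- by move=> s s01; have [_ ->] := Hs s s01.
Qed.

Lemma not_simply_connected_nodal_cell : ~ simply_connected R (closure nodal_cell).
Proof.
move=> [_ /(_ (nodal_loop 0) nodal_loop)].
case.
  split=> //; [|exact: nodal_loop_closure|by rewrite nodal_loop_ends].
  exact/continuous_subspaceT/nodal_loop_continuous.
move=> H [Hc Hcl Hs Ht].
apply: (nodal_loop_no_homotopy H) => // [s s01|t t01]; last first.
  by have [-> ->] := Ht t t01.
have [-> ->] := Hs s s01; split=> //.
by have [|_ ->] := Hs 0; rewrite // in_itv/= lexx ler01.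
Qed.

Lemma not_contractible_nodal_cell : ~ contractible R (closure nodal_cell).
Proof.
move=> [a [H [_ Hc Hcl Ha]]].
have z01 : (0 : R) \in `[0, 1] by rewrite in_itv/= lexx ler01.
(* A contraction composed with the loop is a free homotopy to a constant; its vertical sides agree
   because the loop is closed. *)
apply: (nodal_loop_no_homotopy (fun p => H (nodal_loop p.1, p.2))).
- apply/subspace_continuousP => -[s t] [/= s01 t01].
  have /subspace_continuousP/(_ (nodal_loop s, t)) := Hc.
  have Kst : (closure nodal_cell `*` `[0, 1]) (nodal_loop s, t).
    by split=> //; exact: nodal_loop_closure.
  (* Continuity of [H] is relative to the closure of the cell times [[0, 1]]; it passes to the
     composite because the loop stays in that closure. *)
  move=> /(_ Kst) Hst; apply: (cvg_comp (fun p => (nodal_loop p.1, p.2)) H _ Hst).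
  move=> A [[U V] /= [Us Vt] UVA].
  have := @nodal_loop_continuous s _ Us => lU.
  exists (nodal_loop @^-1` U, V) => //= -[s' t'] [/= Us' Vt'] [/= s'01 t'01].
  apply: (UVA (nodal_loop s', t')) => //=.
  by split=> //; exact: nodal_loop_closure.
- by move=> s t s01 t01; apply: Hcl => //; exact: nodal_loop_closure.
- move=> s s01 /=; have [-> ->] := Ha _ (nodal_loop_closure _ s01); split=> //.
  by have [_ ->] := Ha _ (nodal_loop_closure _ z01).
- by move=> t _ /=; rewrite nodal_loop_ends.
Qed.

End nodal_cell.

Theorem proposition3p7 (R : realType) :
  exists C : set 'rV[R]_4,
    [/\ cad_cell C,
        bounded_set C,
        ~ simply_connected R (closure C) &
        ~ contractible R (closure C)].
Proof.
(* The dimension [1 + 1 + 1 + 1] is convertible to [4]. *)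
exists nodal_cell; split.
- exact: cad_cell_nodal_cell.
- exact: bounded_nodal_cell.
- exact: not_simply_connected_nodal_cell.
- exact: not_contractible_nodal_cell.
Qed.
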